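(* Let $K$ be a primitive quartic CM field whose real quadratic subfield $K_0$ has class number one. Let $\ell$ be a prime with $\ell\mathcal{O}_{K_0}=\mathfrak{l}_1\mathfrak{l}_2$, where $\mathfrak{l}_1\neq\mathfrak{l}_2$ are primes of norm $\ell$. Let $\mathcal{O}$ be an order in $K$ with locally maximal real multiplication at $\ell$. Then the position of $\mathcal{O}_\ell$ within the lattice of $\mathcal{O}_{K_0}$-orders localized at $\ell$ is given by the valuations $\nu_{\mathfrak{l}_i}(\mathfrak{f}_{\mathcal{O}})$, for $i=1,2$.
   Context: A quartic CM field is primitive if it contains no imaginary quadratic subfield. For an order $\mathcal{O}$ of $K$ or $K_0$, $\mathcal{O}_\ell=\mathcal{O}\otimes\mathbb{Z}_\ell$; an order $\mathcal{O}$ of $K$ has locally maximal real multiplication at $\ell$ if $(\mathcal{O}_{K_0})_\ell\subset\mathcal{O}_\ell$. An $\mathcal{O}_{K_0}$-order is an order of $K$ containing $\mathcal{O}_{K_0}$; the lattice of $\mathcal{O}_{K_0}$-orders localized at $\ell$ consists of the rings $\mathcal{O}'_\ell$ for $\mathcal{O}'$ an $\mathcal{O}_{K_0}$-order, ordered by inclusion. The conductor of $\mathcal{O}$ is $\{x\in\mathcal{O}_K: x\mathcal{O}_K\subset\mathcal{O}\}$, and $\mathfrak{f}_{\mathcal{O}}$ here denotes its intersection with $\mathcal{O}_{K_0}$, which is an ideal of $\mathcal{O}_{K_0}$; $\nu_{\mathfrak{l}_i}$ is the $\mathfrak{l}_i$-adic valuation of ideals of $\mathcal{O}_{K_0}$.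 *)

(* Defs.v *)
From HB Require Import structures.
From mathcomp Require Import all_boot all_order all_algebra all_field.
From mathcomp Require Import boolp classical_sets functions cardinality.

Set Implicit Arguments.
Unset Strict Implicit.
Unset Printing Implicit Defensive.

Import Order.TTheory GRing.Theory Num.Theory.
Local Open Scope classical_set_scope.
Local Open Scope ring_scope.
Local Open Scope quotient_scope.
Local Open Scope card_scope.

(* The additive group of the p-adic integers, as the inverse limit of the
   Z/p^n: the n-th term of a sequence is the canonical representative, in
   [0, p^n), of its class modulo p^n.  The coherence condition forces this
   range when p > 0. *)
Section PadicIntegers.
Variable p : nat.

Definition coherent (a : nat -> int) : Prop :=
  forall n, (a n.+1 %% (p ^ n)%N)%Z = a n.

Record padic_int := PadicInt {
  residue :> nat -> int;
  residueP : `[< coherent residue >]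
}.

HB.instance Definition _ := [isSub for residue].
HB.instance Definition _ := [Choice of padic_int by <:].

Lemma padic_eqP (a b : padic_int) : residue a =1 residue b -> a = b.
Proof. by move=> ab; apply: val_inj; apply/funext. Qed.

Lemma padic_modz (a : padic_int) n : (a n %% (p ^ n)%N)%Z = a n.
Proof. by case: a => a /= /asboolP aP; rewrite -aP modz_mod. Qed.

Lemma padic_modzS (a : padic_int) n : (a n.+1 %% (p ^ n)%N)%Z = a n.
Proof. by case: a => a /= /asboolP aP; rewrite aP. Qed.

Lemma modz_modS (m : int) n :
  ((m %% (p ^ n.+1)%N)%Z %% (p ^ n)%N)%Z = (m %% (p ^ n)%N)%Z.
Proof.
by rewrite [in RHS](divz_eq m (p ^ n.+1)%N) !expnS !PoszM mulrA modzMDl.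
Qed.

Lemma coherent_mod (f : nat -> int) :
  (forall n, (f n.+1 %% (p ^ n)%N)%Z = (f n %% (p ^ n)%N)%Z) ->
  `[< coherent (fun n => (f n %% (p ^ n)%N)%Z) >].
Proof. by move=> fP; apply/asboolP => n; rewrite modz_modS. Qed.

Lemma padic_add_subproof (a b : padic_int) n :
  ((a n.+1 + b n.+1) %% (p ^ n)%N)%Z = ((a n + b n) %% (p ^ n)%N)%Z.
Proof. by rewrite -modzDm !padic_modzS. Qed.

Lemma padic_opp_subproof (a : padic_int) n :
  ((- a n.+1) %% (p ^ n)%N)%Z = ((- a n) %% (p ^ n)%N)%Z.
Proof. by rewrite -modzNm padic_modzS. Qed.

Definition padic0 := PadicInt (@coherent_mod (fun=> 0) (fun=> erefl)).
Definition padic_add a b := PadicInt (coherent_mod (padic_add_subproof a b)).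
Definition padic_opp a := PadicInt (coherent_mod (padic_opp_subproof a)).

Lemma padic_addA : associative padic_add.
Proof. by move=> a b c; apply: padic_eqP => n /=; rewrite modzDmr modzDml addrA. Qed.

Lemma padic_addC : commutative padic_add.
Proof. by move=> a b; apply: padic_eqP => n /=; rewrite addrC. Qed.

Lemma padic_add0 : left_id padic0 padic_add.
Proof. by move=> a; apply: padic_eqP => n /=; rewrite mod0z add0r padic_modz. Qed.

Lemma padic_addN : left_inverse padic0 padic_opp padic_add.
Proof. by move=> a; apply: padic_eqP => n /=; rewrite modzDml addNr. Qed.

HB.instance Definition _ :=
  GRing.isZmodule.Build padic_int padic_addA padic_addC padic_add0 padic_addN.

End PadicIntegers.

(* The tensor product over Z of two abelian groups: finite formal sums of pairs
   (standing for pure tensors), identified when every biadditive map takes the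
   same value on them. *)
Section Tensor.
Variables M N : zmodType.

Definition biadditive (A : zmodType) (f : M -> N -> A) : Prop :=
  (forall x y z, f (x + y) z = f x z + f y z) /\
  (forall x y z, f x (y + z) = f x y + f x z).

Definition tensor_equiv (s t : seq (M * N)) : Prop :=
  forall (A : zmodType) (f : M -> N -> A), biadditive f ->
    \sum_(u <- s) f u.1 u.2 = \sum_(u <- t) f u.1 u.2.

Definition tensor_rel (s t : seq (M * N)) : bool := `[< tensor_equiv s t >].

Lemma tensor_rel_equiv : equiv_class_of tensor_rel.
Proof.
split=> [s|s t|t s u].
- by apply/asboolP.
- by apply/asboolP/asboolP => st A f fP; rewrite st.
- by move=> /asboolP st /asboolP tu; apply/asboolP => A f fP; rewrite st ?tu.
Qed.

Canonical tensor_equivRel := EquivRelPack tensor_rel_equiv.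

Definition tensor := {eq_quot tensor_rel}.

End Tensor.

(* A_l, that is, A (x) Z_l, for a subgroup A of L: Z_l is flat over Z, so it is
   identified with its image in L (x) Z_l, where inclusions are compared. *)
Definition localize (L : zmodType) (l : nat) (A : set L) :
    set (tensor L (padic_int l)) :=
  [set t | exists2 s : seq (L * padic_int l),
     forall u, u \in s -> A u.1 & t = \pi s].
Arguments localize {L} l A _ : rename.

(* All embeddings of a number field into the complex numbers take values in the
   field algC of algebraic numbers. *)
Definition totally_real (L : fieldExtType rat) : Prop :=
  forall (s : {rmorphism L -> algC}) (x : L), s x \is Num.real.

Definition totally_imaginary (L : fieldExtType rat) : Prop :=
  forall s : {rmorphism L -> algC}, exists x : L, s x \isn't Num.real.

Section NumberField.
Variable K : fieldExtType rat.
Implicit Types (F : {subfield K}) (A R I J P : set K).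

(* K is a CM field with maximal real subfield F. *)
Definition CM_field F : Prop :=
  [/\ totally_real (subvs_of F), \dim_F {:K} = 2%N & totally_imaginary K].

Definition primitive_CM : Prop :=
  forall F, \dim F = 2%N -> ~ totally_imaginary (subvs_of F).

Definition ring_of_integers F : set K :=
  [set x | x \in F /\ integralOver (intr : int -> K) x].

Definition is_order A : Prop :=
  [/\ A 1, forall x y, A x -> A y -> A (x - y),
      forall x y, A x -> A y -> A (x * y) &
      exists2 b : (\dim {:K}).-tuple K,
        basis_of {:K} b & forall x, A x <-> inIntSpan b x].

(* In what follows the subring R of K plays the role of the ring of integers of
   a subfield, and its ideals are seen as subsets of K. *)

Definition is_ideal R I : Prop :=
  [/\ I `<=` R, I 0, forall x y, I x -> I y -> I (x + y) &
      forall x y, R x -> I y -> I (x * y)].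

Definition prime_ideal R P : Prop :=
  [/\ is_ideal R P, P != [set 0], ~ P 1 &
      forall x y, R x -> R y -> P (x * y) -> P x \/ P y].

Definition scale_set (a : K) I : set K := [set a * x | x in I].

Definition ideal_mul I J : set K :=
  [set x | exists n (a b : 'I_n -> K),
     [/\ forall i, I (a i), forall i, J (b i) & x = \sum_(i < n) a i * b i]].

Definition ideal_exp R I n : set K := iter n (ideal_mul I) R.

Definition ideal_dvd R I J : Prop :=
  exists2 I', is_ideal R I' & J = ideal_mul I I'.

(* The exponent of P in the factorization of I; the default value 0 of xget only
   occurs for ideals divisible by all powers of P or by none. *)
Definition ideal_val R P I : nat :=
  xget 0%N [set n | ideal_dvd R (ideal_exp R P n) I /\
                    ~ ideal_dvd R (ideal_exp R P n.+1) I].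

Definition has_ideal_norm R I (n : nat) : Prop :=
  [set [set y | R y /\ I (y - x)] | x in R] #= `I_n.

Definition nonzero_ideal R I : Prop := is_ideal R I /\ I != [set 0].

Definition ideal_class R I : set (set K) :=
  [set J | nonzero_ideal R J /\
     exists a b : K, [/\ R a /\ a != 0, R b /\ b != 0 &
                         scale_set a I = scale_set b J]].

Definition has_class_number F (h : nat) : Prop :=
  let R := ring_of_integers F in
  [set ideal_class R I | I in nonzero_ideal R] #= `I_h.

(* The conductor of the order A, intersected with the ring of integers of F. *)
Definition real_conductor F A : set K :=
  [set x | ring_of_integers {:K}%AS x /\
           forall y, ring_of_integers {:K}%AS y -> A (x * y)]
    `&` ring_of_integers F.

Definition conductor_val F P A : nat :=
  ideal_val (ring_of_integers F) P (real_conductor F A).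

Definition locally_maximal_RM F (l : nat) A : Prop :=
  localize l (ring_of_integers F) `<=` localize l A.

Definition is_OF_order F A : Prop :=
  is_order A /\ ring_of_integers F `<=` A.

Definition local_order_lattice F (l : nat) : set (set (tensor K (padic_int l))) :=
  [set localize l A | A in is_OF_order F].

End NumberField.
Arguments local_order_lattice {K} F l _ : rename.

(* Main.v *)
Require Import Defs.
From HB Require Import structures.
From mathcomp Require Import all_boot all_order all_algebra all_field.
From mathcomp Require Import ring_quotient.
From mathcomp Require Import boolp classical_sets functions cardinality.
From mathcomp Require Import ring.

(* Write R for the integers of K0, a principal ideal domain. The integers of K
   are R + R w for some w, and an order containing R is R + f w R, where f
   generates its real conductor. An inclusion of localized lattices at l is an
   inclusion up to multiplication by integers prime to l (tested on the
   biadditive map (x, z) |-> x z mod B_(l)), so for such orders it means that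
   f divides m f' for some m prime to l, that is, that the valuations of f at
   the two primes above l are at most those of f'. Finally, if A has locally
   maximal real multiplication and real conductor c R, then A and R + c w R
   agree locally at l. *)

Set Implicit Arguments.
Unset Strict Implicit.
Unset Printing Implicit Defensive.

Import Order.TTheory GRing.Theory Num.Theory.
Local Open Scope classical_set_scope.
Local Open Scope ring_scope.
Local Open Scope quotient_scope.

(** * Localization at l *)

(** Tensors are equal when all biadditive maps agree on them, so a single map that kills the tensors
    with entries in B and still detects x shows that x tensor 1 is not among them. Such a map exists
    because L / B_(l) is l-primary torsion as soon as every element of L has a positive multiple in
    B: on each of its elements an l-adic integer acts through one residue.

    Rational integers prime to l suffice as multipliers for both primes at once. They are units at
    each prime above l, and conversely an element of R comaximal with l divides such an integer, so
    the part of f away from l can be cleared without touching the valuations.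

    Ideals are never factored: class number one replaces them by generators, divisibility of c by a
    becomes membership of c / a in R, and coprimality is a Bezout relation. *)

Definition is_subgroup {L : zmodType} (A : set L) : Prop :=
  A 0 /\ forall x y, A x -> A y -> A (x - y).

Section Subgroup.
Variables (L : zmodType) (A : set L) (subA : is_subgroup A).

Lemma subgroup0 : A 0. Proof. by case: subA. Qed.

Lemma subgroupB x y : A x -> A y -> A (x - y).
Proof. by case: subA => _; apply. Qed.

Lemma subgroupN x : A x -> A (- x).
Proof. by move=> Ax; rewrite -sub0r; apply: subgroupB => //; apply: subgroup0. Qed.

Lemma subgroupD x y : A x -> A y -> A (x + y).
Proof. by move=> Ax Ay; rewrite -[y]opprK; apply: subgroupB => //; apply: subgroupN. Qed.

Lemma subgroupMn x n : A x -> A (x *+ n).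
Proof.
move=> Ax; elim: n => [|n IHn]; first exact: subgroup0.
by rewrite mulrS; apply: subgroupD.
Qed.

Lemma subgroupMz x (n : int) : A x -> A (x *~ n).
Proof.
case: n => n Ax; first by rewrite -pmulrn; apply: subgroupMn.
by rewrite NegzE mulrNz -pmulrn; apply/subgroupN/subgroupMn.
Qed.

(** The dummy argument keeps the proof in the term, so that the closure instance below can be
    inferred from the predicate alone. *)
Definition subgroup_pred (_ : is_subgroup A) : {pred L} := fun x => `[< A x >].

Lemma subgroup_pred_closed : zmod_closed (subgroup_pred subA).
Proof.
split=> [|x y]; first by apply/asboolP/subgroup0.
by move=> /asboolP Ax /asboolP Ay; apply/asboolP/subgroupB.
Qed.

HB.instance Definition _ :=
  GRing.isZmodClosed.Build L (subgroup_pred subA) subgroup_pred_closed.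

Definition quotient_group : zmodType := Quotient.quot (subgroup_pred subA).

Lemma quotient_groupP x y :
  \pi_quotient_group x = \pi_quotient_group y <-> A (x - y).
Proof.
split=> [/eqP|Axy]; first by rewrite -Quotient.idealrBE => /asboolP.
by apply/eqP; rewrite -Quotient.idealrBE; apply/asboolP.
Qed.

End Subgroup.

(** * Division by integers prime to l in the l-adic integers *)

Section Padic.
Variable l : nat.

Lemma padic_modz_le (z : padic_int l) m n : (m <= n)%N ->
  (z n %% (l ^ m)%N)%Z = z m.
Proof.
move=> /subnK <-; elim: (n - m)%N => [|k IHk]; first exact: padic_modz.
rewrite -{}IHk addSn -[in RHS](padic_modzS z (k + m)%N).
rewrite [in LHS](divz_eq (z (k + m).+1) (l ^ (k + m))%N).
by rewrite expnD PoszM mulrA modzMDl.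
Qed.

Definition padic_one : padic_int l :=
  PadicInt (@coherent_mod l (fun=> 1) (fun=> erefl)).

(* Division by an integer prime to l is computed residue by residue. *)
Lemma padic_div (m : nat) (z : padic_int l) : (0 < l)%N -> coprime m l ->
  exists w : padic_int l, w *+ m = z.
Proof.
move=> l0 cml.
have /choice[u uP] n : exists u : int, (u * m == 1 %[mod (l ^ n)%N])%Z.
  have: coprimez m (l ^ n)%N by rewrite /coprimez; apply: (coprimeXr n cml).
  case/coprimezP=> -[u v] /= uv; exists u.
  by apply/eqP; rewrite -uv addrC modzMDl.
(* The inverses [u n] of m are chosen independently for each n; the products are still coherent
   because an inverse modulo l^n is unique. *)
have ucoh n : ((z n.+1 * u n.+1) %% (l ^ n)%N = (z n * u n) %% (l ^ n)%N)%Z.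
  have dvd : (Posz (l ^ n)%N %| Posz (l ^ n.+1)%N)%Z.
    by rewrite dvdzE /= expnS dvdn_mull.
  have u1 : (u n.+1 * m == 1 %[mod (l ^ n)%N])%Z.
    by rewrite eqz_mod_dvd (dvdz_trans dvd) // -eqz_mod_dvd.
  have /eqP uu : (u n.+1 == u n %[mod (l ^ n)%N])%Z.
    rewrite eqz_mod_dvd -(@Gauss_dvdzl _ _ m); last first.
      by rewrite coprimez_sym; apply: (coprimeXr n cml).
    by rewrite mulrBl -eqz_mod_dvd (eqP u1) (eqP (uP n)).
  by rewrite -modzMm padic_modzS uu -[z n in LHS]padic_modz modzMm.
exists (PadicInt (coherent_mod ucoh)).
have mulnE k (w : padic_int l) n : (w *+ k) n = ((w n *+ k) %% (l ^ n)%N)%Z.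
  elim: k => [|k IHk] //; rewrite !mulrS -modzDmr -IHk //.
apply: padic_eqP => n; rewrite mulnE /= -mulr_natr natz modzMml.
by rewrite -mulrA -modzMmr (eqP (uP n)) modzMmr mulr1 padic_modz.
Qed.

End Padic.

Lemma biadditive_sum_eq0 (M N A : zmodType) (f : M -> N -> A) s :
  (forall u, u \in s -> f u.1 u.2 = 0) -> \sum_(u <- s) f u.1 u.2 = 0.
Proof. by move=> s0; rewrite big_seq big1. Qed.


(** * Inclusions of localized subgroups *)

Section Localize.
Variables (L : zmodType) (l : nat).
Implicit Types (A B : set L).

(** For a lattice B in a number field and a prime l, this is the module spanned by B over the
    rationals with denominator prime to l, written B_(l). *)
Definition local_closure B : set L := [set x | exists2 m, coprime m l & B (x *+ m)].

Lemma local_closure_subgroup B : is_subgroup B -> is_subgroup (local_closure B).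
Proof.
move=> subB; split.
  by exists 1%N; [rewrite coprime1n|rewrite mul0rn; apply: subgroup0].
move=> x y [m cm Bm] [n cn Bn]; exists (m * n)%N; first by rewrite coprimeMl cm.
rewrite mulrnBl; apply: subgroupB => //; first by rewrite mulrnA; apply: subgroupMn.
by rewrite mulnC mulrnA; apply: subgroupMn.
Qed.

(** * The action of the l-adic integers on an l-primary quotient L / S *)

Section Evaluation.
Variables (S : set L) (subS : is_subgroup S).
Hypothesis torsion : forall x, exists n, S (x *+ (l ^ n)).

Lemma torsion_congr x n (a b : int) : S (x *+ (l ^ n)) ->
  (a %% (l ^ n)%N)%Z = (b %% (l ^ n)%N)%Z ->
  \pi_(quotient_group subS) (x *~ a) = \pi_(quotient_group subS) (x *~ b).
Proof.
move=> Sx /eqP; rewrite eqz_mod_dvd => /dvdzP[c abc]; apply/quotient_groupP.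
by rewrite -mulrzBr abc mulrC mulrzA -pmulrn; apply: subgroupMz.
Qed.

(* x (x) z is sent to the class of x z, where z may be replaced by any integer
   congruent to it modulo a power of l that kills x in L / S. *)
Lemma torsion_evaluation : exists f : L -> padic_int l -> quotient_group subS,
  biadditive f /\
  forall x z n, S (x *+ (l ^ n)) -> f x z = \pi_(quotient_group subS) (x *~ z n).
Proof.
have /choice[e eP] := torsion.
pose f x (z : padic_int l) := \pi_(quotient_group subS) (x *~ z (e x)).
have fE x (z : padic_int l) n : S (x *+ (l ^ n)) ->
    f x z = \pi_(quotient_group subS) (x *~ z n).
  move=> Sx; rewrite /f; have [le|/ltnW le] := leqP n (e x).
    by apply: torsion_congr Sx _; rewrite padic_modz_le // padic_modz.
  by apply: torsion_congr (eP x) _; rewrite padic_modz padic_modz_le.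
have Sle x m n : (m <= n)%N -> S (x *+ (l ^ m)) -> S (x *+ (l ^ n)).
  by move=> /subnKC <- Sx; rewrite expnD mulrnA; apply: subgroupMn.
exists f; split=> //; split=> [x y z|x y z].
  pose n := maxn (e x) (e y).
  have Sx : S (x *+ (l ^ n)) by apply: Sle (eP x); apply: leq_maxl.
  have Sy : S (y *+ (l ^ n)) by apply: Sle (eP y); apply: leq_maxr.
  have Sxy : S ((x + y) *+ (l ^ n)) by rewrite mulrnDl; apply: subgroupD.
  rewrite !(fE _ _ n) // mulrzDl; exact: raddfD.
rewrite /f -[RHS]raddfD -mulrzDr; apply: torsion_congr (eP x) _ => /=.
by rewrite modz_mod.
Qed.

End Evaluation.

(** If N x lies in B and N = m l^k with m prime to l, then m brings l^k x into B. *)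
Lemma local_closure_torsion B : prime l -> is_subgroup B ->
  (forall x, exists2 n, (0 < n)%N & B (x *+ n)) ->
  forall x, exists n, local_closure B (x *+ (l ^ n)).
Proof.
move=> pl subB fullB x; have [N N0 BxN] := fullB x.
have [m cm Nm] := pfactor_coprime pl N0.
exists (logn l N), m; first by rewrite coprime_sym.
by rewrite -mulrnA mulnC -Nm.
Qed.

(** The test map into L / B_(l) kills every tensor with entries in B and sends x tensor 1 to the
    class of x. Conversely, if m x lies in B with m prime to l, then x tensor z equals m x tensor z
    / m. *)
Lemma localize_subP A B : prime l -> is_subgroup B ->
  (forall x, exists2 n, (0 < n)%N & B (x *+ n)) ->
  (localize l A `<=` localize l B <-> A `<=` local_closure B).
Proof.
move=> pl subB fullB; split=> [sAB x Ax|sAB _ [s sA ->]].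
  have subBl := local_closure_subgroup subB.
  have tors := local_closure_torsion pl subB fullB.
  have [f [fbi fE]] := torsion_evaluation subBl tors.
  have : localize l A (\pi [:: (x, padic_one l)]).
    by exists [:: (x, padic_one l)] => // u; rewrite inE => /eqP ->.
  case/sAB => s sB /eqquotP /asboolP/(_ _ f fbi).
  rewrite big_seq1 /= biadditive_sum_eq0; last first.
    move=> u /sB Bu; rewrite (fE _ _ 0%N); last first.
      by exists 1%N; rewrite ?coprime1n // !mulr1n.
    rewrite -[0](raddf0 (\pi_(quotient_group subBl))).
    apply/quotient_groupP; rewrite subr0.
    apply: subgroupMz => //; exists 1%N; rewrite ?coprime1n // mulr1n //.
  have [n Bn] := tors x.
  (* The residue of [padic_one] modulo l^0 is 0, so the exponent n may fail; at n.+1 the residue is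
     1. *)
  rewrite (fE _ _ n.+1); last by rewrite expnSr mulrnA; apply: subgroupMn.
  rewrite /= modz_small; last first.
    by rewrite /= ltz_nat -[1%N](exp1n n.+1) ltn_exp2r // prime_gt1.
  rewrite -[0](raddf0 (\pi_(quotient_group subBl))).
  by move/quotient_groupP; rewrite subr0.
pose good (u v : L * padic_int l) := B v.1 /\
  forall (C : zmodType) (f : L -> padic_int l -> C), biadditive f ->
    f u.1 u.2 = f v.1 v.2.
have goodP u : u \in s -> exists v, good u v.
  move=> /sA /sAB [m cm Bm]; have [w wm] := padic_div u.2 (prime_gt0 pl) cm.
  exists (u.1 *+ m, w); split=> // C f [fl fr] /=; rewrite -wm.
  have f0l z : f 0 z = 0 by apply: (addrI (f 0 z)); rewrite -fl !addr0.
  have f0r z : f z 0 = 0 by apply: (addrI (f z 0)); rewrite -fr !addr0.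
  have El k : f (u.1 *+ k) w = f u.1 w *+ k.
    by elim: k => [|k IHk]; rewrite ?mulr0n // !mulrS fl IHk.
  have Er k : f u.1 (w *+ k) = f u.1 w *+ k.
    by elim: k => [|k IHk]; rewrite ?mulr0n // !mulrS fr IHk.
  by rewrite El Er.
have [t tB ts] : exists2 t, forall u, u \in t -> B u.1 & tensor_equiv s t.
  elim: s {sA} goodP => [|u s IHs] goodP; first by exists [::].
  have [v [Bv uv]] := goodP u (mem_head u s).
  have [w ws|t tB ts] := IHs; first by apply: goodP; rewrite inE ws orbT.
  exists (v :: t) => [w|C f fbi].
    by rewrite inE => /predU1P[->|/tB].
  by rewrite !big_cons (uv _ _ fbi) (ts _ _ fbi).
by exists t => //; apply/eqquotP/asboolP.
Qed.

End Localize.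

(** * Divisibility in principal subrings of a number field *)

Definition is_subring {K : fieldExtType rat} (R : set K) : Prop :=
  [/\ R 1, forall x y, R x -> R y -> R (x - y) &
      forall x y, R x -> R y -> R (x * y)].

Definition is_principal {K : fieldExtType rat} (R : set K) : Prop :=
  forall I, nonzero_ideal R I ->
    exists a, [/\ R a, a != 0 & I = scale_set a R].

Section Principal.
Variables (K : fieldExtType rat) (R : set K).
Hypotheses (subR : is_subring R) (pidR : is_principal R).

Lemma subring1 : R 1. Proof. by case: subR. Qed.

Lemma subringM x y : R x -> R y -> R (x * y). Proof. by case: subR => _ _; apply. Qed.

Lemma subring_subgroup : is_subgroup R.
Proof. by case: subR => R1 RB _; split=> //; rewrite -(subrr 1); apply: RB. Qed.

Lemma subring0 : R 0. Proof. exact: subgroup0 subring_subgroup. Qed.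

Lemma subringD x y : R x -> R y -> R (x + y).
Proof. exact: (@subgroupD _ _ subring_subgroup). Qed.

Lemma subringB x y : R x -> R y -> R (x - y).
Proof. exact: (@subgroupB _ _ subring_subgroup). Qed.

Lemma subringX x n : R x -> R (x ^+ n).
Proof.
move=> Rx; elim: n => [|n IHn]; first exact: subring1.
by rewrite exprS; apply: subringM.
Qed.

Lemma subring_int (n : int) : R n%:~R.
Proof. by apply: (subgroupMz subring_subgroup); apply: subring1. Qed.

Lemma subring_nat n : R n%:R. Proof. exact: (subring_int n). Qed.

(* For nonzero a, membership of c / a in R says that a divides c. *)
Lemma mem_scale a c : a != 0 -> scale_set a R c <-> R (c / a).
Proof.
move=> a0; split=> [[d Rd <-]|Rca]; first by rewrite mulrAC divff ?mul1r.
by exists (c / a) => //; rewrite mulrC divfK.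
Qed.

Lemma scale_ideal a : R a -> is_ideal R (scale_set a R).
Proof.
move=> Ra; split.
- by move=> _ [x Rx <-]; apply: subringM.
- by exists 0; [apply: subring0|rewrite mulr0].
- by move=> _ _ [x Rx <-] [y Ry <-]; exists (x + y); [apply: subringD|rewrite mulrDr].
- by move=> x _ Rx [y Ry <-]; exists (x * y); [apply: subringM|rewrite mulrCA].
Qed.

Lemma scale_self a : scale_set a R a.
Proof. by exists 1; [apply: subring1|rewrite mulr1]. Qed.

Lemma ideal_mul_scale a (I : set K) : R a -> is_ideal R I ->
  ideal_mul (scale_set a R) I = scale_set a I.
Proof.
move=> Ra [IR I0 ID IM]; apply/seteqP; split=> x.
  case=> n [u [v [uR Iv ->]]].
  have /choice[d dP] i : exists d, R d /\ a * d = u i.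
    by have [d Rd <-] := uR i; exists d.
  exists (\sum_(i < n) d i * v i); last first.
    by rewrite mulr_sumr; apply: eq_bigr => i _; have [_ <-] := dP i; rewrite mulrA.
  elim/big_ind: _ => // i _.
  by apply: IM => //; have [] := dP i.
case=> y Iy <-; exists 1%N, (fun=> a), (fun=> y); split=> // [_|].
  exact: scale_self.
by rewrite big_ord1.
Qed.

Lemma scale_scale a b (I : set K) : scale_set a (scale_set b I) = scale_set (a * b) I.
Proof.
apply/seteqP; split=> x; first by case=> _ [y Iy <-] <-; exists y; rewrite ?mulrA.
by case=> y Iy <-; exists (b * y); [exists y|rewrite mulrA].
Qed.

Lemma scale_exp a n : R a -> ideal_exp R (scale_set a R) n = scale_set (a ^+ n) R.
Proof.
move=> Ra; elim: n => [|n /= IHn].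
  apply/seteqP; split=> [x Rx|x [y Ry <-]]; rewrite expr0.
    by exists x; rewrite ?mul1r.
  by rewrite mul1r.
rewrite /ideal_exp /= -/(ideal_exp _ _ _) IHn ideal_mul_scale ?scale_scale -?exprS //.
exact/scale_ideal/subringX.
Qed.

Lemma ideal_dvd_scale a c : R a -> a != 0 -> R c ->
  ideal_dvd R (scale_set a R) (scale_set c R) <-> R (c / a).
Proof.
move=> Ra a0 Rc; split=> [[I idI cI]|Rca].
  apply/mem_scale => //; have: scale_set c R c by apply: scale_self.
  rewrite cI ideal_mul_scale // => -[d Id <-]; exists d => //.
  by case: idI => + _ _ _; apply.
exists (scale_set (c / a) R); first exact: scale_ideal.
rewrite ideal_mul_scale //; last exact: scale_ideal.
by rewrite scale_scale (mulrC a) divfK.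
Qed.

(* An element divisible by all powers of p would generate, together with its
   quotients by these powers, an ideal without a generator. *)
Lemma exists_not_dvd_exp p c : R p -> p != 0 -> ~ R p^-1 -> R c -> c != 0 ->
  exists n, ~ R (c / p ^+ n).
Proof.
move=> Rp p0 Rp' Rc c0; apply: contrapT => dvd_c.
have {}dvd_c n : R (c / p ^+ n) by apply: contrapT => h; apply: dvd_c; exists n.
pose I : set K := [set x | R x /\ exists n, R (x * p ^+ n / c)].
have [|d [Rd d0 Id]] := pidR (I := I).
  split; first split=> [x []//||x y [Rx [n xn]] [Ry [m ym]]|x y Rx [Ry [n yn]]].
  - by split; [apply: subring0|exists 0%N; rewrite !mul0r; apply: subring0].
  - split; [exact: subringD|exists (n + m)%N].
    have -> : (x + y) * p ^+ (n + m) / c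
        = (x * p ^+ n / c) * p ^+ m + (y * p ^+ m / c) * p ^+ n.
      by rewrite exprD; ring.
    by apply: subringD; apply: subringM => //; apply: subringX.
  - split; [exact: subringM|exists n].
    by rewrite -!mulrA; apply: subringM => //; rewrite mulrA.
  apply/eqP => /seteqP[I0 _]; have : I c; last by move/I0/eqP; rewrite (negPf c0).
  by split=> //; exists 0%N; rewrite mulr1 divff //; apply: subring1.
(* The generator d is a multiple of some c / p^n and divides c / p^(n+1), which would make p a
   unit. *)
have [_ [n dn]] : I d by rewrite Id; apply: scale_self.
have : I (c / p ^+ n.+1).
  split=> //; exists n.+1; rewrite divfK ?divff ?expf_neq0 //; exact: subring1.
rewrite Id => /mem_scale - /(_ d0) cd; apply: Rp'.
have -> : p^-1 = (c / p ^+ n.+1 / d) * (d * p ^+ n / c).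
  by rewrite exprS; field; rewrite expf_neq0 // c0 d0 p0.
exact: subringM.
Qed.

(** The exponents m for which p^m divides c are closed downwards and bounded, so [xget] has a
    witness, the last of them, and its default value never occurs. Valuations are used below only
    through this equivalence. *)
Lemma ideal_valP p c : R p -> p != 0 -> ~ R p^-1 -> R c -> c != 0 ->
  forall m, R (c / p ^+ m) <-> (m <= ideal_val R (scale_set p R) (scale_set c R))%N.
Proof.
move=> Rp p0 Rp' Rc c0.
have dvdE n : ideal_dvd R (ideal_exp R (scale_set p R) n) (scale_set c R)
              <-> R (c / p ^+ n).
  by rewrite scale_exp //; apply: ideal_dvd_scale; rewrite ?expf_neq0 //; apply: subringX.
have dvd_le m n : (m <= n)%N -> R (c / p ^+ n) -> R (c / p ^+ m).
  move=> /subnK <- cn.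
  have -> : c / p ^+ m = c / p ^+ (n - m + m) * p ^+ (n - m).
    by rewrite exprD; field; rewrite !expf_neq0.
  by apply: subringM => //; apply: subringX.
have [n cn cSn] : exists2 n, R (c / p ^+ n) & ~ R (c / p ^+ n.+1).
  have [N ncN] := exists_not_dvd_exp Rp p0 Rp' Rc c0.
  have exN : exists n, `[< ~ R (c / p ^+ n) >] by exists N; apply/asboolP.
  case: (ex_minnP exN) => -[|n] /asboolP cn minn.
    by case: cn; rewrite expr0 divr1.
  exists n => //; apply: contrapT => /asboolP/minn; by rewrite ltnn.
rewrite /ideal_val; case: xgetP => [k _ [/dvdE ck ckS] m|]; last first.
  by move/(_ n)=> []; split=> [|/dvdE]; first exact/dvdE.
have nckS : ~ R (c / p ^+ k.+1) by move=> /dvdE.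
split=> [cm|mk]; last exact: dvd_le ck.
by rewrite leqNgt; apply/negP => /dvd_le /(_ cm).
Qed.

(** Comaximality, which passes to products and powers without unique factorization. *)
Definition coprime_in (a b : K) : Prop := exists u v, [/\ R u, R v & u * a + v * b = 1].

Lemma coprime_in_sym a b : coprime_in a b -> coprime_in b a.
Proof. by case=> u [v [Ru Rv uv]]; exists v, u; rewrite addrC. Qed.

Lemma coprime_inM a b c : R a -> R b -> R c ->
  coprime_in a c -> coprime_in b c -> coprime_in (a * b) c.
Proof.
move=> Ra Rb Rc [u [v [Ru Rv uv]]] [s [t [Rs Rt st]]].
exists (u * s), (u * a * t + v * (s * b + t * c)); split; first exact: subringM.
  by apply: subringD; apply: subringM => //; [apply: subringM|
    apply: subringD; apply: subringM].
rewrite -[RHS]mul1r -{1}uv -st; ring.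
Qed.

Lemma coprime_inX a c n : R a -> R c -> coprime_in a c -> coprime_in (a ^+ n) c.
Proof.
move=> Ra Rc ac; elim: n => [|n IHn].
  by exists 1, 0; split; [exact: subring1|exact: subring0|rewrite expr0; ring].
by rewrite exprS; apply: coprime_inM => //; apply: subringX.
Qed.

Lemma coprime_dvd (a b x : K) : coprime_in a b -> b != 0 ->
  R x -> R (a * x / b) -> R (x / b).
Proof.
move=> [u [v [Ru Rv uv]]] b0 Rx Rax.
have -> : x / b = u * (a * x / b) + v * x.
  by rewrite -{1}[x]mul1r -uv; field.
by apply: subringD; apply: subringM.
Qed.

(** The ideal generated by g and p has a generator d, and d divides p. As p is prime, either p
    divides d, hence also g, or d is a unit. *)
Lemma prime_elt_coprime p g : R p -> p != 0 -> prime_ideal R (scale_set p R) ->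
  R g -> ~ R (g / p) -> coprime_in g p.
Proof.
move=> Rp p0 [_ _ P1 primeP] Rg Rgp.
pose I : set K := [set x | exists u v, [/\ R u, R v & x = u * g + v * p]].
have [|d [Rd d0 Id]] := pidR (I := I).
  split; first split.
  - by move=> _ [u [v [Ru Rv ->]]]; apply: subringD; apply: subringM.
  - by exists 0, 0; split; [exact: subring0|exact: subring0|ring].
  - move=> _ _ [u [v [Ru Rv ->]]] [s [t [Rs Rt ->]]]; exists (u + s), (v + t).
    by split; [exact: subringD|exact: subringD|ring].
  - move=> x _ Rx [u [v [Ru Rv ->]]]; exists (x * u), (x * v).
    by split; [exact: subringM|exact: subringM|ring].
  apply/eqP => /seteqP[I0 _]; have : I p; last by move/I0/eqP; rewrite (negPf p0).
  by exists 0, 1; split; [exact: subring0|exact: subring1|ring].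
have [e Re pde] : scale_set d R p.
  by rewrite -Id; exists 0, 1; split; [exact: subring0|exact: subring1|ring].
have [k Rk gdk] : scale_set d R g.
  by rewrite -Id; exists 1, 0; split; [exact: subring1|exact: subring0|ring].
have [|[d' Rd' dp]|[e' Re' ep]] := primeP d e Rd Re.
- by rewrite pde; apply: scale_self.
- case: Rgp; rewrite -gdk -dp.
  have -> : p * d' * k / p = d' * k by field.
  exact: subringM.
have : I 1.
  rewrite Id; exists e' => //; apply: (mulfI p0).
  by rewrite mulr1 -{2}pde -ep; ring.
by move=> [u [v [Ru Rv uv]]]; exists u, v.
Qed.

End Principal.

Lemma extQ_natr_eq0 (K : fieldExtType rat) n : (n%:R == 0 :> K) = (n == 0%N).
Proof. by rewrite -(rmorph_nat (in_alg K)) fmorph_eq0 pnatr_eq0. Qed.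

(** * Valuations at the two primes above l *)

Section SplitPrime.
Variables (K : fieldExtType rat) (R : set K).
Hypotheses (subR : is_subring R) (pidR : is_principal R).
Hypothesis nat_multiple : forall x : K, R x -> x != 0 ->
  exists2 n, (0 < n)%N & R (n%:R / x).
Variables (l : nat) (p q : K).
Hypotheses (l_prime : prime l) (Rp : R p) (Rq : R q) (p0 : p != 0) (q0 : q != 0).
Hypotheses (p_prime : prime_ideal R (scale_set p R)).
Hypotheses (q_prime : prime_ideal R (scale_set q R)).
Hypothesis pq_neq : scale_set p R <> scale_set q R.
Hypothesis l_split : scale_set l%:R R = scale_set (p * q) R.

Local Notation val x c := (ideal_val R (scale_set x R) (scale_set c R)).

Lemma prime_ideal_nonunit x : x != 0 -> prime_ideal R (scale_set x R) -> ~ R x^-1.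
Proof. by move=> x0 [_ _ P1 _] Rx; apply: P1; apply/mem_scale; rewrite ?div1r. Qed.

Let p_nonunit := prime_ideal_nonunit p0 p_prime.
Let q_nonunit := prime_ideal_nonunit q0 q_prime.

(** If q divided p, then by primality p would divide q, making the two ideals equal, or p / q,
    making q a unit. *)
Let pq_coprime : coprime_in R p q.
Proof.
apply: (prime_elt_coprime subR pidR) => // Rpq; apply: pq_neq.
have pE : p = q * (p / q) by field.
case: (p_prime) => _ _ _ /(_ q (p / q)) []//.
- by rewrite -pE; apply: scale_self.
- move=> /mem_scale - /(_ p0) Rqp; apply/seteqP; split=> x [y Ry <-].
    by rewrite pE -mulrA; exists (p / q * y) => //; apply: subringM.
  have -> : q * y = p * (q / p * y) by field.
  by exists (q / p * y) => //; apply: subringM.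
- move=> /mem_scale - /(_ p0); have -> : p / q / p = q^-1 by field; rewrite p0 q0.
  by [].
Qed.

Let valP_p c := ideal_valP subR pidR Rp p0 p_nonunit (c := c).
Let valP_q c := ideal_valP subR pidR Rq q0 q_nonunit (c := c).

(** Realizes every pair of valuations. If x^(i+1) divided x^i y^j, then x would divide y^j, with
    which it is comaximal, and so be a unit. *)
Lemma val_split a b : val p (p ^+ a * q ^+ b) = a /\ val q (p ^+ a * q ^+ b) = b.
Proof.
have Rf : R (p ^+ a * q ^+ b) by apply: subringM => //; apply: subringX.
have f0 : p ^+ a * q ^+ b != 0 by rewrite mulf_neq0 // expf_neq0.
have main x y i j : R x -> R y -> x != 0 -> ~ R x^-1 -> coprime_in R y x ->
    forall m, R (x ^+ i * y ^+ j / x ^+ m) <-> (m <= i)%N.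
  move=> Rx Ry x0 Rx' yx m; split=> [Rm|mi]; last first.
    have -> : x ^+ i * y ^+ j / x ^+ m = x ^+ (i - m) * y ^+ j.
      by rewrite -{1}(subnK mi) exprD; field; rewrite expf_neq0.
    by apply: subringM => //; apply: subringX.
  rewrite leqNgt; apply/negP => lt_im; apply: Rx'.
  have [s [t [Rs Rt st]]] := coprime_inX subR j Ry Rx yx.
  have -> : x^-1 = s * (y ^+ j / x) + t by rewrite -{1}[x^-1]mul1r -st; field.
  apply: subringD => //; apply: subringM => //.
  have -> : y ^+ j / x = x ^+ i * y ^+ j / x ^+ m * x ^+ (m - i.+1).
    by rewrite -{1}(subnK lt_im) exprD exprS; field; rewrite x0 !expf_neq0.
  by apply: subringM => //; apply: subringX.
split; apply/eqP; rewrite eqn_leq.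
  have E m : (m <= val p (p ^+ a * q ^+ b))%N <-> (m <= a)%N.
    apply: iff_trans (iff_sym (valP_p Rf f0 m)) _.
    exact: (main p q a b Rp Rq p0 p_nonunit (coprime_in_sym pq_coprime) m).
  by apply/andP; split; apply/E.
have E m : (m <= val q (p ^+ a * q ^+ b))%N <-> (m <= b)%N.
  apply: iff_trans (iff_sym (valP_q Rf f0 m)) _.
  by rewrite (mulrC (p ^+ a)); exact: (main q p b a Rq Rp q0 q_nonunit pq_coprime m).
by apply/andP; split; apply/E.
Qed.

(** Modulo x^n the integer m is invertible: u m + v l^n = 1, and x^n divides l^n = x^n y^n. So a
    power of x that divides f, and hence g m, already divides g. *)
Let dvd_val_of_local x y f g m : R x -> R y -> x * y = l%:R -> x != 0 -> R g ->
  coprime m l -> R (g *+ m / f) ->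
  forall n, R (f / x ^+ n) -> f != 0 -> R (g / x ^+ n).
Proof.
move=> Rx Ry xy x0 Rg cml Rgm n Rfn f0.
have /coprimezP[[u v] /= uv] : coprimez m (l ^ n)%N by apply: (coprimeXr n cml).
have {}uv : u%:~R * m%:R + v%:~R * l%:R ^+ n = 1 :> K.
  move/(congr1 (intr : int -> K)): uv.
  by rewrite rmorphD !rmorphM /= -!pmulrn natrX.
have -> : g / x ^+ n = u%:~R * ((g *+ m / f) * (f / x ^+ n)) + v%:~R * (y ^+ n * g).
  rewrite -[LHS]mul1r -{1}uv -xy exprMn -[g *+ m]mulr_natr.
  have : x ^+ n != 0 by rewrite expf_neq0.
  move: (x ^+ n) (y ^+ n) (u%:~R) (v%:~R) (m%:R) => X Y U V M X0.
  by field; rewrite f0 X0.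
by apply: subringD => //; do !apply: subringM => //;
  first [exact: subring_int|exact: subringX].
Qed.

Lemma local_dvdP f g : R f -> R g -> f != 0 -> g != 0 ->
  (exists2 m, coprime m l & R (g *+ m / f)) <->
  (val p f <= val p g)%N /\ (val q f <= val q g)%N.
Proof.
move=> Rf Rg f0 g0.
(* [r] and its inverse [s] are the units by which l and p q differ. *)
have [r Rr lr] : scale_set (p * q) R l%:R by rewrite -l_split; apply: scale_self.
have [s Rs ls] : scale_set l%:R R (p * q) by rewrite l_split; apply: scale_self.
split=> [[m cml Rgm]|].
  split; [apply/(valP_p Rg g0)|apply/(valP_q Rg g0)].
    apply: (@dvd_val_of_local p (q * r) f g m) => //; first exact: subringM.
      by rewrite mulrA.
    exact/(valP_p Rf f0).
  apply: (@dvd_val_of_local q (p * r) f g m) => //; first exact: subringM.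
    by rewrite mulrA (mulrC q).
  exact/(valP_q Rf f0).
move=> [/(valP_p Rg g0) Rgp /(valP_q Rg g0) Rgq].
have := valP_q Rf f0; have := valP_p Rf f0; move: Rgp Rgq.
move: (val p f) (val q f) => a b Rgp Rgq val_p val_q.
have pa0 : p ^+ a != 0 by rewrite expf_neq0.
have qb0 : q ^+ b != 0 by rewrite expf_neq0.
have pqX i j : coprime_in R (p ^+ i) (q ^+ j).
  apply: (coprime_inX subR) => //; first exact: subringX.
  by apply/coprime_in_sym/(coprime_inX subR) => //; apply: coprime_in_sym.
have split_dvd h : R h -> R (h / p ^+ a) -> R (h / q ^+ b) -> R (h / (p ^+ a * q ^+ b)).
  move=> Rh Rhp Rhq; rewrite invfM mulrA.
  apply: (coprime_dvd subR (pqX a b)) => //.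
  by rewrite mulrCA mulfV ?mulr1.
have Rf1 : R (f / (p ^+ a * q ^+ b)).
  by apply: split_dvd => //; [apply/val_p|apply/val_q].
have Rg1 : R (g / (p ^+ a * q ^+ b)).
  exact: split_dvd.
have [h Rh fE] : exists2 h, R h & f = h * (p ^+ a * q ^+ b).
  by exists (f / (p ^+ a * q ^+ b)); rewrite ?divfK // mulf_neq0.
have h0 : h != 0 by apply: contraNneq f0 => h0; rewrite fE h0 mul0r.
have hp : coprime_in R h p.
  apply: (prime_elt_coprime subR pidR) => // Rhp.
  suff /val_p : R (f / p ^+ a.+1) by rewrite ltnn.
  have -> : f / p ^+ a.+1 = h / p * q ^+ b.
    by rewrite fE exprS; field; rewrite p0 pa0.
  by apply: subringM => //; apply: subringX.
have hq : coprime_in R h q.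
  apply: (prime_elt_coprime subR pidR) => // Rhq.
  suff /val_q : R (f / q ^+ b.+1) by rewrite ltnn.
  have -> : f / q ^+ b.+1 = h / q * p ^+ a.
    by rewrite fE exprS; field; rewrite q0 qb0.
  by apply: subringM => //; apply: subringX.
have hl : coprime_in R l%:R h.
  have [||u [v [Ru Rv uv]]] := coprime_inM subR Rp Rq Rh;
    [exact: coprime_in_sym|exact: coprime_in_sym|].
  by exists (u * s), v; split=> //; [apply: subringM|rewrite -mulrA (mulrC s) ls].
have [N N0 RN] := nat_multiple Rh h0.
(* The cofactor [h] of p^a q^b in f divides N = m l^k and is comaximal with l, so it divides m: this
   m clears the part of f away from l. *)
have [m cm Nm] := pfactor_coprime l_prime N0.
exists m; first by rewrite coprime_sym.
have Rmh : R (m%:R / h).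
  have hlX := coprime_inX subR (logn l N) (subring_nat subR l) Rh hl.
  apply: (coprime_dvd subR hlX) => //; first exact: subring_nat.
  by rewrite -natrX -natrM mulnC -Nm.
have -> : g *+ m / f = m%:R / h * (g / (p ^+ a * q ^+ b)).
  by rewrite -[g *+ m]mulr_natr {1}fE; field; rewrite h0 pa0 qb0.
exact: subringM.
Qed.

End SplitPrime.

(** * Rings of integers *)

Section IntegerRings.
Variable K : fieldExtType rat.
Implicit Types (x y : K) (F E : {subfield K}).

Local Notation integral := (integralOver (intr : int -> K)).
Local Notation OO F := (ring_of_integers F).

Lemma int_span_subgroup m (s : m.-tuple K) : is_subgroup [set x | inIntSpan s x].
Proof.
split=> [|_ _ [a ->] [b ->]] /=.
  by exists [ffun=> 0]; rewrite big1 // => i _; rewrite ffunE mulr0z.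
exists [ffun i => a i - b i]; rewrite -sumrB; apply: eq_bigr => i _.
by rewrite ffunE mulrzBr.
Qed.

(* The characteristic polynomial of the matrix of multiplication by y. *)
Lemma integral_stable m (s : m.-tuple K) y : (exists i : 'I_m, s`_i != 0) ->
  (forall i : 'I_m, inIntSpan s (y * s`_i)) -> integral y.
Proof.
move=> [i0 si0] /choice[a aP].
pose M : 'M[int]_m := \matrix_(i, j) a j i.
exists (char_poly M); first exact: char_poly_monic.
rewrite map_char_poly -eigenvalue_root_char; apply/eigenvalueP.
exists (\row_i s`_i).
  apply/rowP=> j; rewrite !mxE aP; apply: eq_bigr => i _.
  by rewrite !mxE mulrzr.
by apply: contra si0 => /eqP/rowP/(_ i0); rewrite !mxE => ->.
Qed.

Lemma span_multiple m (s : m.-tuple K) x : x \in <<s>>%VS ->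
  exists2 n, (0 < n)%N & inIntSpan s (x *+ n).
Proof.
move=> xs; pose d i := `|denq (coord s i x)|%N.
exists (\prod_i d i)%N; first by rewrite prodn_gt0 // => i; rewrite absz_gt0 denq_neq0.
have /choice[a aP] i : exists a : int, coord s i x *+ (\prod_i d i)%N = a%:~R.
  exists (numq (coord s i x) *+ (\prod_(j | j != i) d j)%N).
  rewrite (bigD1 i) //= mulrnA rmorphMn; congr (_ *+ _) => /=.
  by rewrite -mulr_natr numqE /d pmulrn absz_denq.
exists [ffun i => a i]; rewrite {1}(coord_span xs) -sumrMnl; apply: eq_bigr => i _.
by rewrite ffunE scalerMnl aP scaler_int.
Qed.

(** Once n clears the denominators of multiplication by x in a rational basis, n x maps the lattice
    spanned by this basis into itself. *)
Lemma integral_multiple x : exists2 n, (0 < n)%N & integral (x *+ n).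
Proof.
pose b := vbasis {:K}; have bP : <<b>>%VS = {:K}%VS by rewrite (span_basis (vbasisP _)).
have bx (i : 'I_(\dim {:K})) : exists n, (0 < n)%N /\ inIntSpan b ((x * b`_i) *+ n).
  by have [|n n0 ?] := @span_multiple _ b (x * b`_i); rewrite ?bP ?memvf //; exists n.
have /choice[d dP] := bx.
exists (\prod_i d i)%N; first by rewrite prodn_gt0 // => i; have [] := dP i.
apply: (@integral_stable _ b).
  have dim0 : (0 < \dim {:K})%N by apply: adim_gt0.
  exists (Ordinal dim0); apply: (basis_not0 (vbasisP {:K})).
  by rewrite mem_nth // size_tuple.
move=> i; rewrite mulrnAl (bigD1 i) //= mulrnA.
apply: (subgroupMn (int_span_subgroup b)).
by have [] := dP i.
Qed.

Lemma integers_subring F : is_subring (OO F).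
Proof.
split=> [|x y [Fx ix] [Fy iy]|x y [Fx ix] [Fy iy]]; split.
- exact: mem1v.
- exact: integral1.
- exact: rpredB.
- exact: integral_sub.
- exact: rpredM.
- exact: integral_mul.
Qed.

Lemma integers_multiple F x : x \in F -> exists2 n, (0 < n)%N & OO F (x *+ n).
Proof.
move=> Fx; have [n n0 ix] := integral_multiple x; exists n => //.
by split=> //; apply: rpredMn.
Qed.

(** A denominator of x^-1 takes the place of the norm of x. *)
Lemma nat_multiple_integers F x : OO F x -> x != 0 ->
  exists2 n, (0 < n)%N & OO F (n%:R / x).
Proof.
move=> [Fx ix] x0; have [|n n0 On] := @integers_multiple F x^-1; first by rewrite rpredV.
by exists n => //; rewrite mulr_natl.
Qed.

(** The integers are integrally closed; the rational coordinate of x is carried into [algC], where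
    rational algebraic integers are known to be integers. *)
Lemma integers_rational x : OO (1%AS : {subfield K}) x -> exists n : int, x = n%:~R.
Proof.
move=> [/vlineP[a ->] [p mon_p pa]].
suff /intrP[n an] : (ratr a : algC) \is a Num.int.
  exists n; move: an; rewrite -(ratr_int _ n).
  by move/(fmorph_inj (ratr : rat -> algC)) ->; rewrite scaler_int.
apply: Cint_rat_Aint; first exact: Crat_rat.
apply: (@root_monic_Aint (map_poly (intr : int -> algC) p)).
- have : root (map_poly (intr : int -> rat) p) a.
    rewrite -(fmorph_root (in_alg K)) -map_poly_comp /=.
    rewrite (eq_map_poly (g := (intr : int -> K))) // => z /=.
    by rewrite scaler_int.
  rewrite -(fmorph_root (ratr : rat -> algC)) -map_poly_comp /=.
  by rewrite (eq_map_poly (g := (intr : int -> algC))) // => z /=; rewrite ratr_int.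
- exact: monic_map.
- by apply/polyOverP => i; rewrite coef_map /= intr_int.
Qed.

(** Makes [quadratic_integers] applicable to K0 over the rationals. The generator is the least
    positive integer in the ideal. *)
Lemma integers_rational_principal : is_principal (OO (1%AS : {subfield K})).
Proof.
move=> I [[IR I0 ID IM] In0]; set R := OO _ in IR IM *.
have subR : is_subring R := integers_subring _.
have Nint n : R n%:~R by apply: subring_int.
have IN x : I x -> I (- x) by rewrite -mulN1r => Ix; apply: IM => //; apply: (Nint (-1)).
have [x Ix x0] : exists2 x, I x & x != 0.
  apply: contrapT => nI; move/eqP: In0; apply; apply/seteqP; split=> [x Ix|_ ->//].
  by apply: contrapT => /eqP x0; apply: nI; exists x.
have exn : exists n, `[< (0 < n)%N /\ I n%:R >].
  have [n xn] := integers_rational (IR _ Ix).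
  exists `|n|%N; apply/asboolP; split.
    by rewrite absz_gt0; apply: contraNneq x0 => n0; rewrite xn n0.
  rewrite pmulrn abszE; case: (ger0P n) => _; rewrite -?xn //.
  by rewrite rmorphN /= -xn; apply: IN.
case: (ex_minnP exn) => n /asboolP[n0 In] minn.
exists n%:R; split; [exact: (Nint n)|by rewrite extQ_natr_eq0 -lt0n|].
apply/seteqP; split=> [y Iy|_ [y Ry <-]]; last by rewrite mulrC; apply: IM.
have [m ym] := integers_rational (IR _ Iy).
exists (m %/ n)%Z%:~R; first exact: Nint.
have mE : m%:~R = (m %/ n)%Z%:~R * n%:R + (m %% n)%Z%:~R :> K.
  by rewrite {1}(divz_eq m n) intrD intrM.
suff mn0 : (m %% n)%Z = 0.
  by rewrite ym mE mn0 addr0 mulrC.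
have mod0 : 0 <= (m %% n)%Z by rewrite modz_ge0 // -lt0n.
have In' : I (m %% n)%Z%:~R.
  have -> : (m %% n)%Z%:~R = y + - ((m %/ n)%Z%:~R * n%:R) :> K.
    by rewrite ym mE addrAC subrr add0r.
  by apply: ID => //; apply/IN/IM.
apply/eqP; apply: contraT => mn0.
have /minn : `[< (0 < `|(m %% n)%Z|)%N /\ I `|(m %% n)%Z|%N%:R >].
  by apply/asboolP; rewrite absz_gt0 mn0 pmulrn gez0_abs.
rewrite leqNgt -ltz_nat gez0_abs // ltz_pmod //.
Qed.

End IntegerRings.

(** * Integers of a quadratic extension whose base has principal integers *)

Section QuadraticExtension.
Variables (K : fieldExtType rat) (F E : {subfield K}).
Hypotheses (sFE : (F <= E)%VS) (dimE : \dim E = (2 * \dim F)%N).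

Local Notation integral := (integralOver (intr : int -> K)).
Local Notation OO F := (ring_of_integers F).

Lemma quadratic_coords a x : a \in E -> a \notin F -> x \in E ->
  exists p q, [/\ p \in F, q \in F & x = p + q * a].
Proof.
move=> Ea nFa Ex.
have sFaE : (<<F; a>> <= E)%VS by apply/FadjoinP.
have n2 : adjoin_degree F a = 2%N.
  have := dimvS sFaE; rewrite dimE dim_Fadjoin leq_pmul2r ?adim_gt0 // => n_le2.
  have := adjoin_deg_eq1 F a; rewrite (negPf nFa).
  by move: n_le2; rewrite /adjoin_degree; case: (_.-1) => [|[]].
have Fax : x \in <<F; a>>%VS.
  suff /eqP -> : <<F; a>>%VS == E by [].
  by rewrite eqEdim dim_Fadjoin n2 dimE leqnn andbT.
have Fp := polyOverP (Fadjoin_polyOver F a x).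
exists (Fadjoin_poly F a x)`_0, (Fadjoin_poly F a x)`_1; split=> //.
rewrite -{1}(Fadjoin_poly_eq Fax) (@horner_coef_wide _ 2); last first.
  by rewrite -n2 size_Fadjoin_poly.
by rewrite !big_ord_recl big_ord0 /= expr0 mulr1 expr1 addr0.
Qed.

(* A polynomial over F vanishing at a also vanishes at - a: its even and odd
   parts both vanish, since their values at a ^ 2 lie in F. *)
Lemma root_conj a (h : {poly K}) : a \notin F -> a ^+ 2 \in F ->
  h \is a polyOver F -> root h a -> root h (- a).
Proof.
move=> nFa Fa2 Fh; rewrite !rootE -(poly_even_odd h) !hornerE !horner_comp !hornerE.
have [Fe Fo] : (even_poly h).[a ^+ 2] \in F /\ (odd_poly h).[a ^+ 2] \in F.
  by split; apply: rpred_horner => //; apply/polyOverP => i;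
    rewrite (coef_even_poly, coef_odd_poly); apply/polyOverP.
rewrite sqrrN mulrN.
have [->|o0] := eqVneq (odd_poly h).[a ^+ 2] 0; first by rewrite !mul0r oppr0.
rewrite addr_eq0 => /eqP eE; case/negP: nFa.
have -> : a = - ((even_poly h).[a ^+ 2] / (odd_poly h).[a ^+ 2]).
  by rewrite eE; field.
by rewrite rpredN rpred_div.
Qed.

Lemma integral_conj a p q : a \notin F -> a ^+ 2 \in F -> p \in F -> q \in F ->
  integral (p + q * a) -> integral (p - q * a).
Proof.
move=> nFa Fa2 Fp Fq [h mon_h h0]; exists h => //.
set H := map_poly _ h in h0 *.
have HE b : (H \Po (p%:P + q *: 'X)).[b] = H.[p + q * b].
  by rewrite horner_comp !hornerE.
rewrite rootE -mulrN -HE -rootE; apply: root_conj => //; last by rewrite rootE HE.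
apply: polyOver_comp; last by rewrite rpredD ?polyOverC ?polyOverZ ?polyOverX.
by apply/polyOverP => i; rewrite coef_map /= rpred_int.
Qed.

(** Completing the square: if a^2 = t + s a, then 2 a - s has square 4 t + s^2 in F, and a positive
    multiple of it is integral. *)
Lemma quadratic_generator : exists a,
  [/\ a \in E, a \notin F, integral a & a ^+ 2 \in F].
Proof.
have [a Ea nFa] : exists2 a, a \in E & a \notin F.
  apply/subvPn; apply/negP => /dimvS; rewrite dimE.
  by rewrite leqNgt -[X in (X < _)%N]mul1n ltn_pmul2r ?adim_gt0.
have [t [s [Ft Fs a2]]] := quadratic_coords Ea nFa (rpredX 2 Ea).
pose b := 2%:R * a - s.
have two0 : 2%:R != 0 :> K by rewrite extQ_natr_eq0.
have [n n0 ib] := integral_multiple b.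
have nz : n%:R != 0 :> K by rewrite extQ_natr_eq0 -lt0n.
have F2 : 2%:R \in F by apply: rpred_nat.
have Fn : n%:R \in F by apply: rpred_nat.
have bE : b *+ n = n%:R * (2%:R * a - s) by rewrite mulr_natl.
exists (b *+ n); split=> //.
- by rewrite bE; rewrite !(rpredB, rpredM) // (subvP sFE).
- apply: contra nFa => Fb.
  have -> : a = (b *+ n / n%:R + s) / 2%:R by rewrite bE; field; rewrite two0 nz.
  by apply: rpred_div => //; apply: rpredD => //; apply: rpred_div.
have -> : (b *+ n) ^+ 2 = n%:R ^+ 2 * (4%:R * (a ^+ 2 - s * a) + s ^+ 2).
  by rewrite bE; ring.
rewrite a2 addrK; apply: rpredM; first exact: rpredX.
by apply: rpredD; [apply: rpredM => //; apply: rpred_nat|apply: rpredX].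
Qed.

(* Clearing the denominator 2 a ^ 2, the a-coordinates of the integers of E form
   an ideal of the integers of F; any integer of E whose a-coordinate generates
   this ideal can be taken for w. *)
Lemma quadratic_integers : is_principal (OO F) ->
  exists w, [/\ OO E w, w \notin F & forall x, OO E x ->
    exists r s, [/\ OO F r, OO F s & x = r + s * w]].
Proof.
move=> pidF; have [a [Ea nFa ia Fa2]] := quadratic_generator.
have subF := integers_subring F.
have a0 : a != 0 by apply: contraNneq nFa => ->; apply: rpred0.
have two0 : 2%:R != 0 :> K by rewrite extQ_natr_eq0.
(* The difference of p + q a and its conjugate is 2 q a; one more factor a moves it into F and keeps
   it integral. *)
pose c : K := 2%:R * a ^+ 2.
have c0 : c != 0 by rewrite mulf_neq0 // expf_neq0.
have Fc : c \in F by rewrite rpredM // rpred_nat.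
have bound p q : p \in F -> q \in F -> integral (p + q * a) -> OO F (c * q).
  move=> Fp Fq ix; split; first exact: rpredM.
  have iy := integral_conj nFa Fa2 Fp Fq ix.
  have -> : c * q = a * ((p + q * a) - (p - q * a)) by rewrite /c; ring.
  by apply: integral_mul => //; apply: integral_sub.
pose I := [set y | exists p q, [/\ p \in F, q \in F, integral (p + q * a) & y = c * q]].
have [|g [Rg g0 Ig]] := pidF I.
  split; first split.
  - by move=> _ [p [q [Fp Fq ix ->]]]; apply: bound ix.
  - exists 0, 0; split; rewrite ?rpred0 ?mulr0 //.
    by rewrite mul0r addr0; apply: integral0.
  - move=> _ _ [p [q [Fp Fq ix ->]]] [r [s [Fr Fs iy ->]]]; exists (p + r), (q + s).
    split; rewrite ?rpredD ?mulrDr //.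
    have -> : p + r + (q + s) * a = p + q * a + (r + s * a) by ring.
    exact: integral_add.
  - move=> x _ [Fx ix] [p [q [Fp Fq iy ->]]]; exists (x * p), (x * q).
    split; rewrite ?rpredM //; last by ring.
    have -> : x * p + x * q * a = x * (p + q * a) by ring.
    exact: integral_mul.
  apply/eqP => /seteqP[I0 _].
  have : I c.
    exists 0, 1; rewrite add0r mul1r mulr1.
    by split=> //; [apply: rpred0|apply: rpred1].
  by move/I0/eqP; rewrite (negPf c0).
have [p0 [q0 [Fp0 Fq0 iw gE]]] : I g by rewrite Ig; apply: scale_self.
have q0n : q0 != 0 by apply: contraNneq g0 => q00; rewrite gE q00 mulr0.
have FE : {subset F <= E} by apply/subvP.
exists (p0 + q0 * a); split.
- by split=> //; apply: rpredD; [exact: FE|apply: rpredM => //; exact: FE].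
- apply: contra nFa => Fw.
  have -> : a = (p0 + q0 * a - p0) / q0 by field.
  by rewrite rpred_div // rpredB.
move=> x [Ex ix]; have [p [q [Fp Fq xE]]] := quadratic_coords Ea nFa Ex.
have [s Rs sE] : scale_set g (OO F) (c * q) by rewrite -Ig; exists p, q; rewrite -xE.
have qE : q = s * q0 by apply: (mulfI c0); rewrite -sE gE; ring.
exists (x - s * (p0 + q0 * a)), s; split=> //; last by ring.
have [Fs is_] := Rs; split.
  have -> : x - s * (p0 + q0 * a) = p - s * p0 by rewrite xE qE; ring.
  by rewrite rpredB ?rpredM.
by apply: integral_sub => //; apply: integral_mul.
Qed.

End QuadraticExtension.

(** * Relative orders *)

(** I lies in the only class, that of R, so a I = b R with a and b nonzero, and b / a generates
    I. *)
Lemma class_number1_principal (K : fieldExtType rat) (F : {subfield K}) :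
  has_class_number F 1 -> is_principal (ring_of_integers F).
Proof.
have subR := integers_subring F; set R := ring_of_integers F in subR *.
move=> /card_set_bijP[h [hI1 h_inj _]] I nzI.
have nzR : nonzero_ideal R R.
  split; first split=> // [|x y|x y].
  - exact: subring0.
  - exact: subringD.
  - exact: subringM.
  apply/eqP => /seteqP[R0 _]; have /R0/eqP : R 1 by apply: subring1.
  by rewrite oner_eq0.
have hE J : nonzero_ideal R J -> h (ideal_class R J) = 0%N.
  move=> nzJ; have /= := hI1 (ideal_class R J).
  by case: (h _) => // n /(_ _) => /(_ (ex_intro2 _ _ J nzJ erefl)).
have : ideal_class R I R.
  have -> : ideal_class R I = ideal_class R R.
    by apply: h_inj; rewrite ?inE ?hE //; [exists I|exists R].
  by split=> //; exists 1, 1; split=> //; split; rewrite ?oner_neq0 //; apply: subring1.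
move=> [_ [a [b [[Ra a0] [Rb b0] IR]]]].
have [x Ix xb] : scale_set a I b by rewrite IR; apply: scale_self.
have x0 : x != 0 by apply: contraNneq b0 => x0; rewrite -xb x0 mulr0.
have [[sIR _ _ IM] _] := nzI.
exists x; split=> //; first exact: sIR.
apply/seteqP; split=> [y Iy|_ [y Ry <-]]; last by rewrite mulrC; apply: IM.
have [r Rr ry] : scale_set b R (a * y) by rewrite -IR; exists y.
by exists r => //; apply: (mulfI a0); rewrite mulrA xb.
Qed.

(** With natural numbers as indices, the length [\dim {:K}] can be replaced by 4 without casts. *)
Lemma int_spanP (K : fieldExtType rat) m (s : m.-tuple K) x :
  inIntSpan s x <-> exists c : nat -> int, x = \sum_(0 <= i < m) s`_i *~ c i.
Proof.
split=> [[a ->]|[c ->]]; last first.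
  exists [ffun i : 'I_m => c i]; rewrite big_mkord.
  by apply: eq_bigr => i _; rewrite ffunE.
exists (fun k => oapp a 0 (insub k)); rewrite big_mkord.
by apply: eq_bigr => i _; rewrite valK.
Qed.

Section Orders.
Variables (K : fieldExtType rat) (A : set K).
Hypothesis orderA : is_order A.

Lemma order1 : A 1. Proof. by case: orderA. Qed.

Lemma orderM x y : A x -> A y -> A (x * y).
Proof. by case: orderA => _ _ AM _; apply: AM. Qed.

Lemma order_subgroup : is_subgroup A.
Proof. by case: orderA => A1 AB _ _; split=> //; rewrite -(subrr 1); apply: AB. Qed.

Lemma order_multiple x : exists2 n, (0 < n)%N & A (x *+ n).
Proof.
case: orderA => _ _ _ [b /andP[/eqP sb _] AE].
have [|n n0 bn] := @span_multiple _ _ b x; first by rewrite sb memvf.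
by exists n => //; apply/AE.
Qed.

Lemma order_integral x : A x -> ring_of_integers {:K}%AS x.
Proof.
move=> Ax; split; first exact: memvf.
case: orderA => _ _ AM [b bb AE].
have Ab (i : 'I_(\dim {:K})) : A b`_i.
  apply/AE; exists [ffun j => (i == j)%:Z].
  rewrite (bigD1 i) //= ffunE eqxx mulr1z big1 ?addr0 // => j ji.
  by rewrite ffunE eq_sym (negPf ji).
apply: (@integral_stable _ _ b) => [|i]; last by apply/AE/AM.
exists (Ordinal (adim_gt0 {:K}%AS)); apply: (basis_not0 bb).
by rewrite mem_nth // size_tuple adim_gt0.
Qed.

End Orders.

(** * Orders of the form R + f w R *)

Section RelativeOrders.
Variables (K : fieldExtType rat) (K0 : {subfield K}).

Local Notation R := (ring_of_integers K0).
Local Notation OK := (ring_of_integers {:K}%AS).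

Variables (w e : K).
Hypotheses (dimK : \dim {:K} = 4%N) (pidR : is_principal R).
Hypotheses (Ow : OK w) (nK0w : w \notin K0).
Hypothesis OKE : forall x, OK x -> exists r s, [/\ R r, R s & x = r + s * w].
Hypothesis Re : R e.
Hypothesis RE : forall x, R x -> exists m n : int, x = m%:~R + n%:~R * e.

Let subR : is_subring R := integers_subring K0.
Let subOK : is_subring OK := integers_subring {:K}%AS.

Let sROK x : R x -> OK x.
Proof. by case=> _ ix; split=> //; apply: memvf. Qed.

Let coord_inj r s r' s' : R r -> R s -> R r' -> R s' ->
  r + s * w = r' + s' * w -> s = s'.
Proof.
move=> [Fr _] [Fs _] [Fr' _] [Fs' _] rs; apply/eqP; rewrite -subr_eq0.
apply: contraNT nK0w => s0; have -> : w = (r' - r) / (s - s').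
  have -> : r' - r = (s - s') * w.
    by rewrite mulrBl -[s * w](addKr r) rs; ring.
  by field.
by apply: rpred_div; apply: rpredB.
Qed.

Lemma real_conductor_ideal A : is_order A -> nonzero_ideal R (real_conductor K0 A).
Proof.
move=> oA; have subA := order_subgroup oA.
split; first split=> [x []//||x y [[Ox Ax] Rx] [[Oy Ay] Ry]|x y Rx [[Oy Ay] Ry]].
- split; last exact: subring0.
  by split=> [|y _]; [apply: subring0|rewrite mul0r; apply: subgroup0].
- split; last exact: subringD.
  split=> [|z Oz]; first exact: subringD.
  by rewrite mulrDl; apply: subgroupD => //; [apply: Ax|apply: Ay].
- split; last exact: subringM.
  split=> [|z Oz]; first by apply: subringM => //; apply: sROK.
  by rewrite -mulrA mulrCA; apply: Ay; apply: subringM => //; apply: sROK.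
(* The integers of K are spanned over Z by 1, e, w and e w; if n1 e and n2 w lie in A, then n1 n2
   maps all of them into A. *)
have [n1 n1_gt0 An1] := order_multiple oA e.
have [n2 n2_gt0 An2] := order_multiple oA w.
apply/eqP => /seteqP[c0 _].
have : real_conductor K0 A (n1 * n2)%:R.
  split; last exact: subring_nat.
  split=> [|y Oy]; first exact: subring_nat.
  have [r [s [/RE[m [n ->]] /RE[m' [n' ->]] ->]]] := OKE Oy.
  have -> : (n1 * n2)%:R * (m%:~R + n%:~R * e + (m'%:~R + n'%:~R * e) * w)
    = 1 *~ m *+ (n1 * n2) + e *+ n1 *~ n *+ n2 + w *+ n2 *~ m' *+ n1
      + (e *+ n1) * (w *+ n2) *~ n'.
    ring.
  have A1 := order1 oA.
  do ![apply: subgroupD => //|apply: subgroupMn => //|apply: subgroupMz => //].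
  exact: orderM.
by move/c0/eqP; rewrite extQ_natr_eq0 muln_eq0 !eqn0Ngt n1_gt0 n2_gt0.
Qed.

Definition split_order f : set K :=
  [set x | exists r s, [/\ R r, R s & x = r + s * (f * w)]].

Lemma split_order_is_order f : R f -> f != 0 -> is_OF_order K0 (split_order f).
Proof.
move=> Rf f0; split; last first.
  by move=> x Rx; exists x, 0; split=> //; [apply: subring0|rewrite mul0r addr0].
have full x : exists2 n, (0 < n)%N & split_order f (x *+ n).
  have [|n n0 On] := @integers_multiple _ {:K}%AS x; first exact: memvf.
  have [r [s [Rr Rs xE]]] := OKE On.
  have [N N0 RN] := nat_multiple_integers Rf f0.
  exists (n * N)%N; first by rewrite muln_gt0 n0.
  exists (r *+ N), (s * (N%:R / f)); split; [|exact: subringM|].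
    by apply: subgroupMn => //; apply: subring_subgroup.
  by rewrite mulrnA xE; field.
pose bs := [:: 1; e; f * w; e * (f * w)].
have sz : size bs == \dim {:K} by rewrite dimK.
pose b := Tuple sz.
have bsum (c : nat -> int) : \sum_(0 <= i < \dim {:K}) b`_i *~ c i =
    1 *~ c 0%N + (e *~ c 1%N + (f * w *~ c 2%N + e * (f * w) *~ c 3%N)).
  transitivity (\sum_(0 <= i < 4) bs`_i *~ c i); first by rewrite -[4%N]dimK.
  by rewrite !big_nat_recl //= big_geq // addr0.
have bE x : split_order f x <-> inIntSpan b x.
  split=> [[r [s [/RE[m [n ->]] /RE[m' [n' ->]] ->]]]|/int_spanP[c ->]].
    apply/int_spanP; exists (nth 0 [:: m; n; m'; n']).
    rewrite bsum /=; ring.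
  rewrite bsum.
  exists ((c 0%N)%:~R + (c 1%N)%:~R * e), ((c 2%N)%:~R + (c 3%N)%:~R * e).
  split; last by ring.
    by apply: subringD => //; [|apply: subringM => //]; apply: subring_int.
  by apply: subringD => //; [|apply: subringM => //]; apply: subring_int.
split.
- by exists 1, 0; split; [exact: subring1|exact: subring0|rewrite mul0r addr0].
- move=> _ _ [r [s [Rr Rs ->]]] [r' [s' [Rr' Rs' ->]]].
  exists (r - r'), (s - s'); split; [exact: subringB|exact: subringB|ring].
- move=> _ _ [r [s [Rr Rs ->]]] [r' [s' [Rr' Rs' ->]]].
  have [u [v [Ru Rv w2]]] := OKE (subringM subOK Ow Ow).
  exists (r * r' + s * s' * (f * f * u)), (r * s' + s * r' + s * s' * (f * v)).
  split; [by do ![apply: subringD => //|apply: subringM => //]..|].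
  have -> : (r + s * (f * w)) * (r' + s' * (f * w))
    = r * r' + (r * s' + s * r') * (f * w) + s * s' * (f * f) * (w * w) by ring.
  rewrite w2; ring.
exists b => //.
(* The tuple has as many entries as the dimension, so spanning suffices, and [full] puts a positive
   multiple of each x in its integral span. *)
rewrite basisEdim size_tuple leqnn andbT; apply/subvP => x _.
have [n n0 /bE[a xE]] := full x.
have -> : x = (n%:R : rat)^-1 *: (x *+ n).
  by rewrite -scaler_nat scalerA mulVf ?scale1r // pnatr_eq0 -lt0n.
rewrite memvZ // xE memv_suml // => i _.
by rewrite rpredMz // memv_span // mem_nth // size_tuple.
Qed.

Lemma split_order_conductor f : R f -> f != 0 ->
  real_conductor K0 (split_order f) = scale_set f R.
Proof.
move=> Rf f0; apply/seteqP; split=> [x [[_ Ax] Rx]|_ [x Rx <-]].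
  have [r [s [Rr Rs xw]]] := Ax w Ow.
  exists s => //; rewrite mulrC.
  apply: (@coord_inj r _ 0 _) => //; [exact: subringM|exact: subring0|].
  by rewrite add0r xw mulrA.
have Rfx : R (f * x) by apply: subringM.
split=> //; split=> [|y /OKE[r [s [Rr Rs ->]]]]; first exact: sROK.
exists (f * x * r), (x * s); split; [exact: subringM|exact: subringM|ring].
Qed.

(** If r + s w lies in B, so does s w since R is contained in B; then s (R + R w) lies in B, so s is
    in the conductor and is a multiple of f. *)
Lemma OF_orderE B : is_OF_order K0 B ->
  exists f, [/\ R f, f != 0 & B = split_order f].
Proof.
move=> [oB RB]; have subB := order_subgroup oB.
have [f [Rf f0 cB]] := pidR (real_conductor_ideal oB).
exists f; split=> //; apply/seteqP; split=> x.
  move=> Bx; have [r [s [Rr Rs xE]]] := OKE (order_integral oB Bx).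
  have Bsw : B (s * w).
    by rewrite -(addKr r (s * w)) -xE addrC; apply: subgroupB => //; apply: RB.
  have [t Rt ts] : scale_set f R s.
    rewrite -cB; split=> //; split=> [|y /OKE[r' [s' [Rr' Rs' ->]]]]; first exact: sROK.
    have -> : s * (r' + s' * w) = s * r' + s' * (s * w) by ring.
    by apply: subgroupD => //; [apply: RB; apply: subringM|apply: orderM => //; apply: RB].
  by exists r, t; split=> //; rewrite xE -ts; ring.
move=> [r [s [Rr Rs ->]]].
have [[_ Bf] _] : real_conductor K0 B f by rewrite cB; apply: scale_self.
by apply: subgroupD => //; [apply: RB|apply: orderM => //; [apply: RB|apply: Bf]].
Qed.

Lemma split_order_local l f g : R f -> f != 0 -> R g ->
  split_order g `<=` local_closure l (split_order f) <->
  exists2 m, coprime m l & R (g *+ m / f).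
Proof.
move=> Rf f0 Rg; split=> [sgf|[m cml Rm] x [r [s [Rr Rs ->]]]].
  have [|m cml [r [s [Rr Rs gE]]]] := sgf (g * w).
    by exists 0, 1; split; [exact: subring0|exact: subring1|ring].
  exists m => //; suff -> : g *+ m = s * f by rewrite mulfK.
  have Rgm : R (g *+ m) by apply: subgroupMn => //; apply: subring_subgroup.
  apply: (@coord_inj 0 _ r _) => //; [exact: subring0|exact: subringM|].
  by rewrite add0r mulrnAl gE mulrA.
exists m => //; exists (r *+ m), (s * (g *+ m / f)); split.
- by apply: subgroupMn => //; apply: subring_subgroup.
- exact: subringM.
by field.
Qed.

(* Some m prime to l multiplies R into A, so A and R + c w, for c a generator of
   the real conductor of A, have the same localization at l. *)
Lemma locally_split_order l A : prime l -> is_order A -> locally_maximal_RM K0 l A ->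
  exists f, [/\ R f, f != 0, real_conductor K0 A = scale_set f R &
                localize l A = localize l (split_order f)].
Proof.
move=> pl oA; have subA := order_subgroup oA.
move=> /(localize_subP _ pl subA (order_multiple oA)) RA.
(* As R = Z + Z e, the m found for e serves for all of R. *)
have [m cm Am] := RA e Re.
have RmA r k : R r -> A (r *+ (m * k)).
  move=> /RE[i [j ->]]; rewrite mulrnA; apply: subgroupMn => //.
  have -> : (i%:~R + j%:~R * e) *+ m = 1 *~ i *+ m + e *+ m *~ j.
    by ring.
  apply: subgroupD => //; last exact: subgroupMz.
  by apply: subgroupMn => //; apply: subgroupMz => //; apply: order1.
have [f [Rf f0 cA]] := pidR (real_conductor_ideal oA).
exists f; split=> //.
have [oB RB] := split_order_is_order Rf f0.
apply/seteqP; split.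
  apply/(localize_subP _ pl (order_subgroup oB) (order_multiple oB)) => x Ax.
  (* One factor m brings s w into A and another brings s' into A; the third does no harm. *)
  exists (m * (m * m))%N; first by rewrite !coprimeMl cm.
  have [r [s [Rr Rs xE]]] := OKE (order_integral oA Ax).
  have Asw : A ((s * w) *+ m).
    have -> : (s * w) *+ m = x *+ m - r *+ (m * 1) by rewrite muln1 xE; ring.
    by apply: subgroupB => //; [apply: subgroupMn|apply: RmA].
  have [t Rt ts] : scale_set f R (s *+ (m * (m * m))).
    have Rsm : R (s *+ (m * (m * m))).
      by apply: subgroupMn => //; apply: subring_subgroup.
    rewrite -cA; split=> //; split=> [|y /OKE[r' [s' [Rr' Rs' ->]]]]; first exact: sROK.
    have -> : s *+ (m * (m * m)) * (r' + s' * w) =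
      (s * r') *+ (m * (m * m)) + (s * w) *+ m * s' *+ (m * m).
      by ring.
    apply: subgroupD => //; first by apply: RmA; apply: subringM.
    have -> : (s * w) *+ m * s' *+ (m * m) = (s * w) *+ m *+ m * (s' *+ (m * 1)).
      by ring.
    by apply: orderM => //; [apply: subgroupMn|apply: RmA].
  exists (r *+ (m * (m * m))), t; split=> //.
    by apply: subgroupMn => //; apply: subring_subgroup.
  have -> : t * (f * w) = (f * t) * w by ring.
  by rewrite ts xE; ring.
apply/(localize_subP _ pl subA (order_multiple oA)) => _ [r [s [Rr Rs ->]]].
exists m => //; rewrite mulrnDl -[m]muln1; apply: subgroupD => //; first exact: RmA.
apply: subgroupMn => //.
have [[_ Af] _] : real_conductor K0 A f by rewrite cA; apply: scale_self.
by rewrite mulrCA; apply: Af; apply: subringM => //; apply: sROK.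
Qed.

End RelativeOrders.

(** The three clauses express position: they identify the lattice with pairs of natural numbers
    under the reversed componentwise order, and place the localization of A at the pair given by its
    own conductor. *)
Theorem lemma10 (K : fieldExtType rat) (K0 : {subfield K})
    (l : nat) (l1 l2 A : set K) :
  \dim {:K} = 4%N -> CM_field K0 -> primitive_CM K ->
  has_class_number K0 1 ->
  prime l ->
  prime_ideal (ring_of_integers K0) l1 ->
  prime_ideal (ring_of_integers K0) l2 ->
  l1 <> l2 ->
  has_ideal_norm (ring_of_integers K0) l1 l ->
  has_ideal_norm (ring_of_integers K0) l2 l ->
  scale_set l%:R (ring_of_integers K0) = ideal_mul l1 l2 ->
  is_order A -> locally_maximal_RM K0 l A ->
  [/\ local_order_lattice K0 l (localize l A),
      forall B : set K, is_OF_order K0 B ->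
        (localize l A `<=` localize l B <->
           (conductor_val K0 l1 B <= conductor_val K0 l1 A)%N /\
           (conductor_val K0 l2 B <= conductor_val K0 l2 A)%N) /\
        (localize l B `<=` localize l A <->
           (conductor_val K0 l1 A <= conductor_val K0 l1 B)%N /\
           (conductor_val K0 l2 A <= conductor_val K0 l2 B)%N) &
      forall n1 n2 : nat, exists2 B : set K, is_OF_order K0 B &
        conductor_val K0 l1 B = n1 /\ conductor_val K0 l2 B = n2].
Proof.
move=> dimK [_ dimKK0 _] _ /class_number1_principal pidR pl P1 P2 l12 _ _ lE oA locA.
(* [\dim_K0 {:K}] is a truncated quotient; among the dimensions from 1 to 4, only 2 makes it equal
   to 2. *)
have dimK0 : \dim K0 = 2%N.
  have := dimvS (subvf K0); move: dimKK0 (adim_gt0 K0); rewrite dimK.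
  by case: (\dim K0) => [|[|[|[|[|]]]]].
have subR := integers_subring K0.
have [w [Ow nK0w OKE]] : exists w, [/\ ring_of_integers {:K}%AS w, w \notin K0 &
    forall x, ring_of_integers {:K}%AS x -> exists r s,
      [/\ ring_of_integers K0 r, ring_of_integers K0 s & x = r + s * w]].
  by apply: quadratic_integers => //; rewrite ?subvf // dimK dimK0.
have [e [Re _ RE]] : exists e, [/\ ring_of_integers K0 e, e \notin (1%AS : {subfield K}) &
    forall x, ring_of_integers K0 x -> exists r s,
      [/\ ring_of_integers (1%AS : {subfield K}) r,
          ring_of_integers (1%AS : {subfield K}) s & x = r + s * e]].
  apply: quadratic_integers; [exact: sub1v|by rewrite dimK0 dimv1|].
  exact: integers_rational_principal.
have {}RE x : ring_of_integers K0 x -> exists m n : int, x = m%:~R + n%:~R * e.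
  move=> /RE[_ [_ [/integers_rational[m ->] /integers_rational[n ->] ->]]].
  by exists m, n.
have nzI P : prime_ideal (ring_of_integers K0) P -> nonzero_ideal (ring_of_integers K0) P.
  by case.
have [p [Rp p0 l1E]] := pidR _ (nzI _ P1).
have [q [Rq q0 l2E]] := pidR _ (nzI _ P2).
subst l1 l2.
have {}lE : scale_set l%:R (ring_of_integers K0) = scale_set (p * q) (ring_of_integers K0).
  by rewrite lE ideal_mul_scale ?scale_scale //; apply: scale_ideal.
have [f [Rf f0 cA locAE]] := locally_split_order dimK pidR Ow OKE Re RE pl oA locA.
have splitO := split_order_is_order dimK Ow OKE Re RE.
have cond := split_order_conductor Ow nK0w OKE.
(* Both comparisons of A with B reduce to this one, since A shares its localization and its real
   conductor with [split_order K0 w f]. *)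
have cmp g h : ring_of_integers K0 g -> g != 0 -> ring_of_integers K0 h -> h != 0 ->
    localize l (split_order K0 w g) `<=` localize l (split_order K0 w h) <->
    (conductor_val K0 (scale_set p (ring_of_integers K0)) (split_order K0 w h) <=
     conductor_val K0 (scale_set p (ring_of_integers K0)) (split_order K0 w g))%N /\
    (conductor_val K0 (scale_set q (ring_of_integers K0)) (split_order K0 w h) <=
     conductor_val K0 (scale_set q (ring_of_integers K0)) (split_order K0 w g))%N.
  move=> Rg g0 Rh h0; rewrite /conductor_val !cond //.
  have [oh _] := splitO h Rh h0.
  apply: iff_trans (localize_subP _ pl (order_subgroup oh) (order_multiple oh)) _.
  apply: iff_trans (split_order_local nK0w _ Rh h0 Rg) _.
  exact: (local_dvdP subR pidR (@nat_multiple_integers _ K0) pl Rp Rq p0 q0 P1 P2 l12 lE).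
have cvA P : conductor_val K0 P A = conductor_val K0 P (split_order K0 w f).
  by rewrite /conductor_val cA cond.
split=> [|B /(OF_orderE pidR Ow OKE RE)|n1 n2].
- by exists (split_order K0 w f) => //; apply: splitO.
- by move=> [g [Rg g0 ->]]; rewrite !cvA locAE; split; apply: cmp.
have Rpq : ring_of_integers K0 (p ^+ n1 * q ^+ n2) by apply: subringM => //; apply: subringX.
have pq0 : p ^+ n1 * q ^+ n2 != 0 by rewrite mulf_neq0 // expf_neq0.
exists (split_order K0 w (p ^+ n1 * q ^+ n2)); first exact: splitO.
rewrite /conductor_val !cond //.
exact: (val_split subR pidR Rp Rq p0 q0 P1 P2 l12).
Qed.
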